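(* Let $\lambda\in\mathbb{C}$ and $t_0>0$, and consider the scalar equation $$\ddot y(t)+\frac{3}{t}\dot y(t)+\lambda y(t)=0,\qquad t\in[t_0,\infty),\quad y(t)\in\mathbb{C}.$$ If $\lambda\ne0$, its general solution is $$y(t)=\frac1t\left[c_1J_1(\sqrt\lambda\,t)+c_2Y_1(\sqrt\lambda\,t)\right],$$ where $c_1,c_2\in\mathbb{C}$ are determined by the initial conditions. If $\lambda=0$, the general solution is $y(t)=c_1+c_2t^{-2}$.
   Context: $J_1$ and $Y_1$ are the Bessel functions of the first and second kind of order $1$ (principal branches). $\sqrt\lambda$ denotes the square root with $\Re(\sqrt\lambda)\ge0$. *)

(* Defs.v *)
From Stdlib Require Import Reals Factorial.
From Coquelicot Require Import Coquelicot.

Open Scope R_scope.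

(** Derivative of [f] at [t] relative to the half-line [t0, +oo): this is
    Coquelicot's [is_derive] with [locally t] restricted to the half-line, i.e.
    the usual derivative for [t0 < t] and the right derivative at [t = t0].
    Values of [f] to the left of [t0] are irrelevant. *)
Definition is_derive_from (t0 : R) (f : R -> C) (t : R) (l : C) : Prop :=
  @filterdiff R_AbsRing R_NormedModule C_R_NormedModule f
    (within (fun u : R => t0 <= u) (locally t))
    (fun h : R => @scal R_AbsRing C_R_NormedModule h l).

(** Sum of a complex series; meaningful when the series converges. *)
Definition CSeries (a : nat -> C) : C :=
  (Series (fun k => Re (a k)), Series (fun k => Im (a k))).

(** Principal argument, in (-PI, PI], for [z <> 0]. *)
Definition Carg (z : C) : R :=
  if Rle_dec 0 (Im z) then acos (Re z / Cmod z) else - acos (Re z / Cmod z).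

(** Principal logarithm, for [z <> 0]. *)
Definition Clog (z : C) : C := (ln (Cmod z), Carg z).

(** [s] is a square root of [lam] with nonnegative real part.  It is unique
    unless [lam] is a negative real, where both purely imaginary roots qualify. *)
Definition is_Csqrt (lam s : C) : Prop := (s * s)%C = lam /\ 0 <= Re s.

Definition harmonic (n : nat) : R := sum_n_m (fun k => / INR k) 1 n.

Definition euler_gamma : R :=
  real (Lim_seq (fun n => harmonic n - ln (INR n))).

(** The digamma function at the positive integer [n + 1]. *)
Definition digamma_S (n : nat) : R := harmonic n - euler_gamma.

(** J_1(z) = sum_k (-1)^k / (k! (k+1)!) (z/2)^(2k+1). *)
Definition BesselJ1 (z : C) : C :=
  CSeries (fun k =>
    (RtoC ((-1) ^ k / (INR (fact k) * INR (fact (k + 1)))) *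
     (z / 2) ^ (2 * k + 1))%C).

(** Principal branch of Y_1 (also written N_1), for [z <> 0], with cut along
    (-oo, 0]; DLMF 10.8.1 or Abramowitz-Stegun 9.1.11 at order 1:
      Y_1(z) = - 2/(pi z) + (2/pi) log(z/2) J_1(z)
        - (1/pi) sum_k (-1)^k (psi(k+1) + psi(k+2)) / (k! (k+1)!) (z/2)^(2k+1). *)
Definition BesselY1 (z : C) : C :=
  (- (2 / (RtoC PI * z)) + 2 / RtoC PI * Clog (z / 2) * BesselJ1 z
   - / RtoC PI * CSeries (fun k =>
       RtoC ((-1) ^ k * (digamma_S k + digamma_S (k + 1)) /
             (INR (fact k) * INR (fact (k + 1)))) *
       (z / 2) ^ (2 * k + 1)))%C.

Definition is_solution (lam : C) (t0 : R) (y : R -> C) : Prop :=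
  exists dy ddy : R -> C, forall t : R, t0 <= t ->
    is_derive_from t0 y t (dy t) /\
    is_derive_from t0 dy t (ddy t) /\
    (ddy t + RtoC (3 / t) * dy t + lam * y t)%C = RtoC 0.

(** [g c1 c2] is the general solution: the solutions are exactly the functions
    agreeing on [t0, +oo) with some [g c1 c2], and the constants are determined
    by the (arbitrary) initial values y(t0) = y0 and y'(t0) = v0. *)
Definition is_general_solution (lam : C) (t0 : R) (g : C -> C -> R -> C) : Prop :=
  (forall y : R -> C,
     is_solution lam t0 y <->
     exists c1 c2 : C, forall t : R, t0 <= t -> y t = g c1 c2 t) /\
  (forall y0 v0 : C, exists! c : C * C,
     g (fst c) (snd c) t0 = y0 /\
     is_derive_from t0 (g (fst c) (snd c)) t0 v0).

(* Main.v *)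
Require Import Defs.
From Stdlib Require Import Reals Factorial Lra Lia.
From Coquelicot Require Import Coquelicot.

Open Scope R_scope.

(** If [y] and [z] both solve the equation, [t^3] times their Wronskian is constant, since the
    damping coefficient is [3 / t].  Hence two solutions [y1], [y2] with nonzero Wronskian at [t0]
    span all solutions: the coefficients of [y] are quotients of Wronskians, and no separate
    uniqueness theorem for the initial value problem is needed.

    For [lam = s^2 <> 0] put [m = lam / 4] and [x = t^2].  Then [J_1(s t) / t = (s / 2) P(x)] and
    [Y_1(s t) / t = - 2 / (pi s x) + (s / pi) ((log t + log (s / 2)) P(x) - Q(x) / 2)] for
    entire power series [P], [Q], and the Bessel equation reduces to
    [x P'' + 2 P' + m P = 0] and [x Q'' + 2 Q' + m Q = 2 P' + (P - 1) / x], which are recurrences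
    between coefficients.  The Wronskian is found by letting [x] tend to [0] in the conserved
    quantity.  Euler's constant enters only through the fact that it is a constant: changing
    it would add a multiple of [J_1] to [Y_1]. *)

(** * Derivatives of complex functions of a real variable *)

Notation is_Cderive := (@is_derive R_AbsRing C_R_NormedModule).

Lemma is_Cderive_Re (f : R -> C) t l :
  is_Cderive f t l -> is_derive (fun u => Re (f u)) t (Re l).
Proof.
intros H. unfold is_derive in *.
apply (filterdiff_ext_lin _ (fun h => fst (@scal R_AbsRing C_R_NormedModule h l))).
- apply (@filterdiff_comp R_AbsRing R_NormedModule C_R_NormedModule R_NormedModule
           _ _ f (fun z => fst z) _ (fun z => fst z)); [exact H|].
  apply filterdiff_linear, is_linear_fst.
- reflexivity.
Qed.

Lemma is_Cderive_Im (f : R -> C) t l :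
  is_Cderive f t l -> is_derive (fun u => Im (f u)) t (Im l).
Proof.
intros H. unfold is_derive in *.
apply (filterdiff_ext_lin _ (fun h => snd (@scal R_AbsRing C_R_NormedModule h l))).
- apply (@filterdiff_comp R_AbsRing R_NormedModule C_R_NormedModule R_NormedModule
           _ _ f (fun z => snd z) _ (fun z => snd z)); [exact H|].
  apply filterdiff_linear, is_linear_snd.
- reflexivity.
Qed.

Lemma norm_C_R (z : C) : @norm R_AbsRing C_R_NormedModule z = Cmod z.
Proof.
change (sqrt (Rabs (fst z) ^ 2 + Rabs (snd z) ^ 2) = Cmod z).
now rewrite !pow2_abs.
Qed.

Lemma is_linear_RtoC : @is_linear R_AbsRing R_NormedModule C_R_NormedModule RtoC.
Proof.
split.
- intros x y. apply injective_projections; simpl; unfold plus; simpl; ring.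
- intros k x. apply injective_projections; simpl; unfold scal; simpl; unfold mult; simpl; ring.
- exists 1. split; [lra|]. intros x. rewrite Rmult_1_l.
  rewrite norm_C_R, Cmod_R. apply Rle_refl.
Qed.

Lemma is_linear_mul_Ci : @is_linear R_AbsRing R_NormedModule C_R_NormedModule (fun x => (0, x)).
Proof.
split.
- intros x y. apply injective_projections; simpl; unfold plus; simpl; ring.
- intros k x. apply injective_projections; simpl; unfold scal; simpl; unfold mult; simpl; ring.
- exists 1. split; [lra|]. intros x. rewrite Rmult_1_l.
  rewrite norm_C_R. change (Cmod (0, x) <= Rabs x). unfold Cmod; simpl.
  replace (0 * (0 * 1) + x * (x * 1)) with (Rsqr x) by (unfold Rsqr; ring).
  rewrite sqrt_Rsqr_abs. lra.
Qed.

(** The curve is the sum of [f] followed by [RtoC] and [g] followed by [x -> (0, x)]. Both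
    embeddings are linear, hence their own differentials. *)
Lemma is_Cderive_pair (f g : R -> R) (t a b : R) :
  is_derive f t a -> is_derive g t b -> is_Cderive (fun u => (f u, g u)) t (a, b).
Proof.
intros Hf Hg.
assert (Hf' : is_Cderive (fun u => RtoC (f u)) t (RtoC a)).
{ unfold is_derive in *. apply (filterdiff_ext_lin _ (fun h : R => RtoC (h * a))).
  - apply (@filterdiff_comp R_AbsRing R_NormedModule R_NormedModule C_R_NormedModule
           _ _ f RtoC _ RtoC); [exact Hf|].
    apply filterdiff_linear, is_linear_RtoC.
  - intros h. exact (linear_scal _ is_linear_RtoC h a). }
assert (Hg' : is_Cderive (fun u => (0, g u)) t (0, b)).
{ unfold is_derive in *. apply (filterdiff_ext_lin _ (fun h : R => (0, h * b))).
  - apply (@filterdiff_comp R_AbsRing R_NormedModule R_NormedModule C_R_NormedModule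
           _ _ g (fun x => (0, x)) _ (fun x => (0, x))); [exact Hg|].
    apply filterdiff_linear, is_linear_mul_Ci.
  - intros h. exact (linear_scal _ is_linear_mul_Ci h b). }
generalize (is_derive_plus _ _ _ _ _ Hf' Hg'). intros H.
replace (a, b) with (@plus C_R_NormedModule (RtoC a) (0, b)).
- eapply is_derive_ext; [|exact H].
  intros u. apply injective_projections; simpl; unfold plus; simpl; ring.
- apply injective_projections; simpl; unfold plus; simpl; ring.
Qed.

Lemma is_Cderive_iff (f : R -> C) t l :
  is_Cderive f t l <->
  is_derive (fun u => Re (f u)) t (Re l) /\ is_derive (fun u => Im (f u)) t (Im l).
Proof.
split.
- intros H; split; [apply is_Cderive_Re | apply is_Cderive_Im]; exact H.
- intros [H1 H2]. rewrite (surjective_pairing l).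
  eapply is_derive_ext; [|exact (is_Cderive_pair _ _ _ _ _ H1 H2)].
  intros u. symmetry. apply surjective_pairing.
Qed.

Lemma is_Cderive_eq (f : R -> C) (t : R) (l l' : C) :
  is_Cderive f t l -> l = l' -> is_Cderive f t l'.
Proof. intros H <-; exact H. Qed.

Lemma is_Cderive_const (c : C) t : is_Cderive (fun _ => c) t (RtoC 0).
Proof. exact (@is_derive_const R_AbsRing C_R_NormedModule c t). Qed.

Lemma is_Cderive_plus (f g : R -> C) t a b :
  is_Cderive f t a -> is_Cderive g t b -> is_Cderive (fun u => (f u + g u)%C) t (a + b)%C.
Proof. exact (@is_derive_plus R_AbsRing C_R_NormedModule f g t a b). Qed.

Lemma is_Cderive_opp (f : R -> C) t a :
  is_Cderive f t a -> is_Cderive (fun u => (- f u)%C) t (- a)%C.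
Proof. exact (@is_derive_opp R_AbsRing C_R_NormedModule f t a). Qed.

Lemma is_Cderive_minus (f g : R -> C) t a b :
  is_Cderive f t a -> is_Cderive g t b -> is_Cderive (fun u => (f u - g u)%C) t (a - b)%C.
Proof. intros Hf Hg. apply is_Cderive_plus; [|apply is_Cderive_opp]; assumption. Qed.

(** Here C is only a real normed module, so the rule is assembled from four real product rules, on
    real and imaginary parts. *)
Lemma is_Cderive_mult (f g : R -> C) t a b :
  is_Cderive f t a -> is_Cderive g t b ->
  is_Cderive (fun u => (f u * g u)%C) t (a * g t + f t * b)%C.
Proof.
intros Hf%is_Cderive_iff Hg%is_Cderive_iff. destruct Hf as [Hf1 Hf2], Hg as [Hg1 Hg2].
assert (M : forall (p q : R -> R) x y, is_derive p t x -> is_derive q t y ->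
  is_derive (fun u => p u * q u) t (x * q t + p t * y)).
{ intros p q x y Hp Hq. exact (is_derive_mult p q t x y Hp Hq Rmult_comm). }
apply is_Cderive_iff; split.
- evar_last.
  + exact (is_derive_minus _ _ _ _ _ (M _ _ _ _ Hf1 Hg1) (M _ _ _ _ Hf2 Hg2)).
  + unfold minus, plus, opp; simpl. unfold Re, Im. ring.
- evar_last.
  + exact (is_derive_plus _ _ _ _ _ (M _ _ _ _ Hf1 Hg2) (M _ _ _ _ Hf2 Hg1)).
  + unfold plus; simpl. unfold Re, Im. ring.
Qed.

Lemma is_Cderive_cmul (c : C) (f : R -> C) t l :
  is_Cderive f t l -> is_Cderive (fun u => c * f u)%C t (c * l)%C.
Proof.
intros H. refine (is_Cderive_eq _ _ _ _ (is_Cderive_mult _ _ _ _ _ (is_Cderive_const c t) H) _).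
ring.
Qed.

Lemma is_Cderive_comp (f : R -> C) (g : R -> R) t a b :
  is_Cderive f (g t) a -> is_derive g t b ->
  is_Cderive (fun u => f (g u)) t (RtoC b * a)%C.
Proof.
intros Hf Hg. refine (is_Cderive_eq _ _ _ _ (is_derive_comp f g t a b Hf Hg) _).
apply injective_projections; simpl; unfold scal; simpl; unfold mult; simpl; ring.
Qed.

Lemma is_Cderive_RtoC (f : R -> R) t a :
  is_derive f t a -> is_Cderive (fun u => RtoC (f u)) t (RtoC a).
Proof. intros H. apply is_Cderive_pair; [exact H | apply (is_derive_const 0)]. Qed.

(** The mean value theorem fails for complex values, so it is applied to the real and imaginary
    parts separately. *)
Lemma is_Cderive_0_constant (f : R -> C) (a : R) :
  (forall t, a <= t -> is_Cderive f t (RtoC 0)) -> forall t, a <= t -> f t = f a.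
Proof.
intros H t Ht.
assert (K : forall p : R -> R, (forall u, a <= u -> is_derive p u 0) -> p t = p a).
{ intros p Hp. destruct (MVT_gen p a t (fun _ => 0)) as [c [_ Hc]].
  - intros x Hx. rewrite Rmin_left in Hx by lra. apply Hp. lra.
  - intros x Hx. rewrite Rmin_left in Hx by lra.
    apply continuity_pt_filterlim, (ex_derive_continuous p x). exists 0. apply Hp. lra.
  - lra. }
apply injective_projections.
- apply (K (fun u => Re (f u))). intros u Hu. apply (is_Cderive_Re f u (RtoC 0)), H, Hu.
- apply (K (fun u => Im (f u))). intros u Hu. apply (is_Cderive_Im f u (RtoC 0)), H, Hu.
Qed.

(** * One-sided derivatives on the half-line *)

Definition slope_error (f : R -> C) (t : R) (l : C) (eps : posreal) (u : R) : Prop :=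
  @norm R_AbsRing C_R_NormedModule
    (minus (minus (f u) (f t)) (scal (minus u t : R) l)) <=
  eps * @norm R_AbsRing R_NormedModule (minus u t).

(** [filterdiff] quantifies over all limit points of its filter. Since [t] itself lies in the
    half-line, the restricted filter is proper and [t] is its only limit point. *)
Lemma is_derive_from_iff (t0 : R) (f : R -> C) (t : R) (l : C) :
  t0 <= t ->
  is_derive_from t0 f t l <->
  forall eps : posreal, locally t (fun u => t0 <= u -> slope_error f t l eps u).
Proof.
intros Ht. split.
- intros [_ H] eps.
  refine (H t _ eps). intros P HP. unfold within. now apply filter_imp with (2 := HP).
- intros H. split; [apply is_linear_scal_l|].
  intros x Hx.
  assert (x = t) as ->.
  { refine (@is_filter_lim_unique R_AbsRing R_NormedModule
              (within (fun u => t0 <= u) (locally t)) _ x t Hx _).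
    - split; [|apply within_filter, locally_filter].
      intros HF. apply (locally_singleton _ _ HF), Ht.
    - intros P HP. unfold within. now apply filter_imp with (2 := HP). }
  exact H.
Qed.

Lemma is_Cderive_slope (f : R -> C) t l :
  is_Cderive f t l <-> forall eps : posreal, locally t (slope_error f t l eps).
Proof.
split.
- intros [_ H] eps. refine (H t _ eps). intros P HP; exact HP.
- intros H. split; [apply is_linear_scal_l|].
  intros x Hx.
  assert (x = t) as ->.
  { symmetry; apply (@is_filter_lim_locally_unique R_AbsRing R_NormedModule), Hx. }
  exact H.
Qed.

Lemma is_Cderive_from (t0 : R) (f : R -> C) t l :
  t0 <= t -> is_Cderive f t l -> is_derive_from t0 f t l.
Proof.
intros Ht Hf. apply is_derive_from_iff; [exact Ht|]. intros eps.
generalize (proj1 (is_Cderive_slope f t l) Hf eps). apply filter_imp. auto.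
Qed.

Lemma is_derive_from_ext (t0 : R) (f g : R -> C) t l :
  t0 <= t -> (forall u, t0 <= u -> f u = g u) ->
  is_derive_from t0 f t l -> is_derive_from t0 g t l.
Proof.
intros Ht E Hf. apply is_derive_from_iff; [exact Ht|]. intros eps.
generalize (proj1 (is_derive_from_iff t0 f t l Ht) Hf eps). apply filter_imp.
intros u Hu Hu0. unfold slope_error. rewrite <- (E u Hu0), <- (E t Ht). exact (Hu Hu0).
Qed.

(* Continuing [f] to the left of [t0] by its tangent line makes the one-sided derivative at [t0]
   two-sided. *)
Definition affine_ext (t0 : R) (f : R -> C) (l : C) (u : R) : C :=
  if Rle_dec t0 u then f u else (f t0 + RtoC (u - t0) * l)%C.

Lemma affine_ext_right t0 f l u : t0 <= u -> affine_ext t0 f l u = f u.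
Proof. intros H. unfold affine_ext. destruct (Rle_dec t0 u); [reflexivity | contradiction]. Qed.

Lemma is_Cderive_affine_ext (t0 : R) (f df : R -> C) :
  (forall t, t0 <= t -> is_derive_from t0 f t (df t)) ->
  forall t, t0 <= t -> is_Cderive (affine_ext t0 f (df t0)) t (df t).
Proof.
intros H t Ht. apply is_Cderive_slope. intros eps.
generalize (proj1 (is_derive_from_iff t0 f t (df t) Ht) (H t Ht) eps). intros Hf.
destruct (Rle_lt_or_eq_dec t0 t Ht) as [Hlt | <-].
- assert (Hl : locally t (fun u => t0 < u)) by now apply open_gt.
  generalize (filter_and _ _ Hf Hl). apply filter_imp.
  intros u [Hu Hu0]. unfold slope_error. rewrite !affine_ext_right by lra. apply Hu. lra.
- revert Hf. apply filter_imp. intros u Hu.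
  destruct (Rle_dec t0 u) as [Hu0 | Hu0].
  + unfold slope_error. rewrite !affine_ext_right by lra. exact (Hu Hu0).
  (* To the left of [t0] the extension coincides with its tangent line, so the slope error is
     exactly zero. *)
  + unfold slope_error. rewrite (affine_ext_right t0 f _ t0) by lra. unfold affine_ext.
    destruct (Rle_dec t0 u) as [Hu1 | _]; [contradiction|].
    match goal with |- norm ?z <= _ => replace z with (@zero C_R_NormedModule) end.
    * rewrite norm_zero. apply Rmult_le_pos; [apply Rlt_le, cond_pos | apply norm_ge_0].
    * apply injective_projections; simpl; unfold zero, minus, plus, opp, scal; simpl;
        unfold mult; simpl; ring.
Qed.

(** Subtracting the two slope estimates at a single point to the right of [t0] bounds the norm of
    [l - l'] by an arbitrary [e]. *)
Lemma is_derive_from_unique (t0 : R) (f : R -> C) l l' :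
  is_derive_from t0 f t0 l -> is_derive_from t0 f t0 l' -> l = l'.
Proof.
intros H H'.
pose proof (proj1 (is_derive_from_iff _ _ _ _ (Rle_refl t0)) H) as K.
pose proof (proj1 (is_derive_from_iff _ _ _ _ (Rle_refl t0)) H') as K'.
assert (N : @norm R_AbsRing C_R_NormedModule (minus l l') = 0).
{ apply Rle_antisym; [|apply norm_ge_0].
  apply le_epsilon. intros e He. rewrite Rplus_0_l.
  assert (He2 : 0 < e / 2) by lra.
  destruct (filter_and _ _ (K (mkposreal _ He2)) (K' (mkposreal _ He2))) as [d Hd].
  (* This point is strictly to the right of [t0], inside the ball of radius [d] on which both
     estimates hold with [e / 2]. *)
  set (u := t0 + d / 2).
  assert (Hd0 := cond_pos d).
  destruct (Hd u) as [A B].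
  { change (Rabs (u - t0) < d). unfold u. rewrite Rabs_pos_eq; lra. }
  specialize (A ltac:(unfold u; lra)). specialize (B ltac:(unfold u; lra)).
  unfold slope_error in A, B. simpl in A, B.
  assert (Hn : @norm R_AbsRing R_NormedModule (minus u t0) = d / 2).
  { change (Rabs (u - t0) = d / 2). unfold u. rewrite Rabs_pos_eq; lra. }
  rewrite Hn in A, B.
  assert (S : @norm R_AbsRing C_R_NormedModule (scal (minus u t0 : R) (minus l l'))
              = d / 2 * @norm R_AbsRing C_R_NormedModule (minus l l')).
  { rewrite !norm_C_R.
    replace (scal (minus u t0 : R) (minus l l') : C_R_NormedModule)
      with (RtoC (d / 2) * (l - l'))%C.
    - rewrite Cmod_mult, Cmod_R, Rabs_pos_eq by lra. reflexivity.
    - unfold u; apply injective_projections; simpl; unfold minus, plus, opp, scal; simpl;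
        unfold mult; simpl; ring. }
  set (p := minus (minus (f u) (f t0)) (scal (minus u t0 : R) l) : C_R_NormedModule) in *.
  set (q := minus (minus (f u) (f t0)) (scal (minus u t0 : R) l') : C_R_NormedModule) in *.
  assert (E : (scal (minus u t0 : R) (minus l l') : C_R_NormedModule) = plus q (opp p)).
  { unfold p, q. apply injective_projections; simpl; unfold minus, plus, opp, scal; simpl;
        unfold mult; simpl; ring. }
  rewrite E in S.
  generalize (norm_triangle q (opp p)). rewrite S, norm_opp. intros T.
  apply Rmult_le_reg_l with (d / 2); [lra|].
  eapply Rle_trans; [exact T|]. lra. }
apply norm_eq_zero in N.
apply injective_projections.
- apply (f_equal fst) in N. change (fst l - fst l' = 0) in N. lra.
- apply (f_equal snd) in N. change (snd l - snd l' = 0) in N. lra.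
Qed.

(** * General solutions and Wronskians *)

(** Unlike in [is_solution], derivatives are two-sided even at [a], so that the ordinary
    differentiation rules apply there; [affine_ext] brings a solution on the half-line to this
    form. *)
Definition solves (lam : C) (a : R) (y dy ddy : R -> C) : Prop :=
  forall t, a <= t -> is_Cderive y t (dy t) /\ is_Cderive dy t (ddy t) /\
    (ddy t + RtoC (3 / t) * dy t + lam * y t)%C = RtoC 0.

Definition wronskian (y dy z dz : R -> C) (t : R) : C := (y t * dz t - dy t * z t)%C.

Lemma RtoC_neq_0 (x : R) : x <> 0 -> RtoC x <> RtoC 0.
Proof. intros H E. apply H, RtoC_inj, E. Qed.

Lemma wronskian_constant (lam : C) (a : R) (y dy ddy z dz ddz : R -> C) :
  0 < a -> solves lam a y dy ddy -> solves lam a z dz ddz ->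
  forall t, a <= t ->
    (RtoC (t ^ 3) * wronskian y dy z dz t = RtoC (a ^ 3) * wronskian y dy z dz a)%C.
Proof.
intros Ha Hy Hz.
apply (is_Cderive_0_constant (fun t => RtoC (t ^ 3) * wronskian y dy z dz t)%C).
intros t Ht.
destruct (Hy t Ht) as [Y1 [Y2 Y3]]. destruct (Hz t Ht) as [Z1 [Z2 Z3]].
assert (D : is_derive (fun u => u ^ 3) t (3 * t ^ 2)) by (auto_derive; [easy | ring]).
refine (is_Cderive_eq _ _ _ _ (is_Cderive_mult _ _ _ _ _ (is_Cderive_RtoC _ _ _ D)
  (is_Cderive_minus _ _ _ _ _ (is_Cderive_mult _ _ _ _ _ Y1 Z2)
                              (is_Cderive_mult _ _ _ _ _ Y2 Z1))) _).
assert (Ct : RtoC t <> RtoC 0) by (apply RtoC_neq_0; lra).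
(* Once both second derivatives are eliminated by the equations, the vanishing of the derivative is
   an identity in the values and first derivatives. *)
assert (Ey : ddy t = (- (RtoC (3 / t) * dy t + lam * y t))%C).
{ replace (ddy t) with ((ddy t + RtoC (3 / t) * dy t + lam * y t)
    - (RtoC (3 / t) * dy t + lam * y t))%C by ring. rewrite Y3. ring. }
assert (Ez : ddz t = (- (RtoC (3 / t) * dz t + lam * z t))%C).
{ replace (ddz t) with ((ddz t + RtoC (3 / t) * dz t + lam * z t)
    - (RtoC (3 / t) * dz t + lam * z t))%C by ring. rewrite Z3. ring. }
rewrite Ey, Ez, RtoC_div, RtoC_mult, !RtoC_pow by lra. field. exact Ct.
Qed.

Lemma general_solution_of_wronskian (lam : C) (t0 : R) (y1 dy1 ddy1 y2 dy2 ddy2 : R -> C)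
    (g : C -> C -> R -> C) :
  0 < t0 -> solves lam t0 y1 dy1 ddy1 -> solves lam t0 y2 dy2 ddy2 ->
  wronskian y1 dy1 y2 dy2 t0 <> RtoC 0 ->
  (forall c1 c2 t, t0 <= t -> g c1 c2 t = (c1 * y1 t + c2 * y2 t)%C) ->
  is_general_solution lam t0 g.
Proof.
intros Ht0 H1 H2 HW Hg.
assert (Hcomb : forall c1 c2 (u1 du1 u2 du2 : R -> C) t,
  is_Cderive u1 t (du1 t) -> is_Cderive u2 t (du2 t) ->
  is_Cderive (fun s => c1 * u1 s + c2 * u2 s)%C t (c1 * du1 t + c2 * du2 t)%C).
{ intros c1 c2 u1 du1 u2 du2 t D1 D2.
  apply is_Cderive_plus; apply is_Cderive_cmul; assumption. }
assert (Hd : forall c1 c2 t, t0 <= t ->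
  is_derive_from t0 (g c1 c2) t (c1 * dy1 t + c2 * dy2 t)%C).
{ intros c1 c2 t Ht.
  apply (is_derive_from_ext t0 (fun s => c1 * y1 s + c2 * y2 s)%C); [exact Ht | |].
  - intros u Hu. symmetry. now apply Hg.
  - apply is_Cderive_from; [exact Ht|]. apply Hcomb; [apply H1 | apply H2]; exact Ht. }
split; [intros y; split|].
- intros [dy [ddy Hy]].
  assert (Hs : solves lam t0 (affine_ext t0 y (dy t0)) (affine_ext t0 dy (ddy t0)) ddy).
  { intros t Ht. rewrite !affine_ext_right by exact Ht. split; [|split].
    - apply is_Cderive_affine_ext; [|exact Ht]. intros u Hu. apply Hy, Hu.
    - apply is_Cderive_affine_ext; [|exact Ht]. intros u Hu. apply Hy, Hu.
    - apply Hy, Ht. }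
  set (W := wronskian y1 dy1 y2 dy2 t0) in *.
  (* Cramer's rule for the values of [y] and [dy] at [t0]. *)
  exists (wronskian y dy y2 dy2 t0 / W)%C, (wronskian y1 dy1 y dy t0 / W)%C.
  intros t Ht. rewrite Hg by exact Ht.
  generalize (wronskian_constant _ _ _ _ _ _ _ _ Ht0 Hs H2 t Ht)
    (wronskian_constant _ _ _ _ _ _ _ _ Ht0 H1 Hs t Ht)
    (wronskian_constant _ _ _ _ _ _ _ _ Ht0 H1 H2 t Ht).
  unfold wronskian at 1 2 3 4. rewrite !affine_ext_right by lra.
  fold (wronskian y dy y2 dy2 t) (wronskian y dy y2 dy2 t0)
    (wronskian y1 dy1 y dy t) (wronskian y1 dy1 y dy t0) W.
  intros E1 E2 E3.
  assert (C3 : RtoC (t0 ^ 3) <> RtoC 0) by (apply RtoC_neq_0, pow_nonzero; lra).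
  (* Expansion of a 3 by 3 determinant with two equal rows [y, y1, y2] and third row of derivatives,
     times [t^3]. Each factor [t^3 W] may then be replaced by its value at [t0]. *)
  assert (I : (y t * (RtoC (t ^ 3) * wronskian y1 dy1 y2 dy2 t) =
      RtoC (t ^ 3) * wronskian y dy y2 dy2 t * y1 t
      + RtoC (t ^ 3) * wronskian y1 dy1 y dy t * y2 t)%C).
  { unfold wronskian. ring. }
  rewrite E1, E2, E3 in I.
  replace (y t) with (y t * (RtoC (t0 ^ 3) * W) / (RtoC (t0 ^ 3) * W))%C
    by (field; split; assumption).
  rewrite I. field. split; assumption.
- intros [c1 [c2 Hc]].
  exists (fun t => c1 * dy1 t + c2 * dy2 t)%C, (fun t => c1 * ddy1 t + c2 * ddy2 t)%C.
  intros t Ht. split; [|split].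
  + apply (is_derive_from_ext t0 (g c1 c2)); [exact Ht | | now apply Hd].
    intros u Hu. symmetry. now apply Hc.
  + apply is_Cderive_from; [exact Ht|]. apply Hcomb; [apply H1 | apply H2]; exact Ht.
  + rewrite Hc, Hg by exact Ht.
    destruct (H1 t Ht) as [_ [_ E1]]. destruct (H2 t Ht) as [_ [_ E2]].
    transitivity (c1 * (ddy1 t + RtoC (3 / t) * dy1 t + lam * y1 t)
                  + c2 * (ddy2 t + RtoC (3 / t) * dy2 t + lam * y2 t))%C; [ring|].
    rewrite E1, E2. ring.
- intros y0 v0. unfold wronskian in HW.
  (* Cramer's rule for the 2 by 2 system given by the initial data. *)
  exists ((y0 * dy2 t0 - v0 * y2 t0) / wronskian y1 dy1 y2 dy2 t0,
          (y1 t0 * v0 - dy1 t0 * y0) / wronskian y1 dy1 y2 dy2 t0)%C.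
  unfold wronskian. split.
  + split; simpl.
    * rewrite Hg by lra. field. exact HW.
    * match goal with |- is_derive_from _ (g ?c ?d) _ _ =>
        replace v0 with (c * dy1 t0 + d * dy2 t0)%C at 3 by (field; exact HW) end.
      apply Hd. lra.
  + intros [c1 c2] [E D]; simpl in E, D.
    rewrite Hg in E by lra.
    (* Uniqueness of the one-sided derivative turns the condition on [v0] into the second linear
       equation for [c1] and [c2]. *)
    assert (V := is_derive_from_unique _ _ _ _ D (Hd c1 c2 t0 (Rle_refl t0))).
    subst v0 y0. f_equal; field; exact HW.
Qed.

Lemma zero_frequency_general_solution (t0 : R) : 0 < t0 ->
  is_general_solution (RtoC 0) t0 (fun (c1 c2 : C) (t : R) => (c1 + c2 * RtoC (/ t ^ 2))%C).
Proof.
intros Ht0.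
apply general_solution_of_wronskian with
  (y1 := fun _ => RtoC 1) (dy1 := fun _ => RtoC 0) (ddy1 := fun _ => RtoC 0)
  (y2 := fun t => RtoC (/ t ^ 2)) (dy2 := fun t => RtoC (-2 / t ^ 3))
  (ddy2 := fun t => RtoC (6 / t ^ 4)).
- exact Ht0.
- intros t Ht. split; [|split]; [apply is_Cderive_const | apply is_Cderive_const | ring].
- intros t Ht. assert (t <> 0) by lra. split; [|split].
  + apply is_Cderive_RtoC. auto_derive; [exact (pow_nonzero t 2 H) | now field].
  + apply is_Cderive_RtoC. auto_derive; [exact (pow_nonzero t 3 H) | now field].
  + rewrite <- !RtoC_mult, <- !RtoC_plus. f_equal. now field.
- unfold wronskian. rewrite <- !RtoC_mult, <- RtoC_minus. apply RtoC_neq_0.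
  (* The Wronskian is [-2 / t0^3]. *)
  intros E. assert (t0 <> 0) by lra. assert (F : 1 * (-2 / t0 ^ 3) * t0 ^ 3 = -2) by now field.
  replace (1 * (-2 / t0 ^ 3)) with 0 in F; lra.
- intros c1 c2 t Ht. ring.
Qed.

(** * Complex power series of a real variable *)

Definition entire (c : nat -> C) : Prop :=
  CV_radius (fun k => Re (c k)) = p_infty /\ CV_radius (fun k => Im (c k)) = p_infty.

(** The variable stays real because it will be [t^2]; the complex parameter goes into the
    coefficients, and real power series theory applies to each component. *)
Definition CPSeries (c : nat -> C) (x : R) : C :=
  (PSeries (fun k => Re (c k)) x, PSeries (fun k => Im (c k)) x).

Definition CPS_derive (c : nat -> C) (k : nat) : C := (RtoC (INR (S k)) * c (S k))%C.

Definition CPS_incr (c : nat -> C) (k : nat) : C :=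
  match k with O => RtoC 0 | S j => c j end.

Definition CPS_decr (c : nat -> C) (k : nat) : C := c (S k).

Definition CPS_plus (c d : nat -> C) (k : nat) : C := (c k + d k)%C.

Definition CPS_scal (m : C) (c : nat -> C) (k : nat) : C := (m * c k)%C.

Lemma CV_radius_plus_infty a b :
  CV_radius a = p_infty -> CV_radius b = p_infty -> CV_radius (PS_plus a b) = p_infty.
Proof.
intros Ha Hb. generalize (CV_radius_plus a b). rewrite Ha, Hb. simpl.
now destruct (CV_radius (PS_plus a b)).
Qed.

Lemma CV_radius_scal_infty r a :
  CV_radius a = p_infty -> CV_radius (PS_scal r a) = p_infty.
Proof.
intros Ha. destruct (Req_dec r 0) as [-> | Hr].
- rewrite <- CV_radius_const_0. apply CV_radius_ext. intros n.
  unfold PS_scal, scal; simpl; unfold mult; simpl; ring.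
- now rewrite CV_radius_scal.
Qed.

Lemma CV_radius_infty_inside a x : CV_radius a = p_infty -> Rbar_lt (Rabs x) (CV_radius a).
Proof. now intros ->. Qed.

Lemma entire_plus c d : entire c -> entire d -> entire (CPS_plus c d).
Proof. intros [? ?] [? ?]. split; apply CV_radius_plus_infty; assumption. Qed.

Lemma CV_radius_Cscal (p q : R) (a b : nat -> R) :
  CV_radius a = p_infty -> CV_radius b = p_infty ->
  CV_radius (fun k => p * a k + q * b k) = p_infty.
Proof.
intros Ha Hb.
rewrite <- (CV_radius_plus_infty _ _ (CV_radius_scal_infty p a Ha) (CV_radius_scal_infty q b Hb)).
now apply CV_radius_ext.
Qed.

Lemma PSeries_Cscal (p q : R) (a b : nat -> R) x :
  CV_radius a = p_infty -> CV_radius b = p_infty ->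
  PSeries (fun k => p * a k + q * b k) x = p * PSeries a x + q * PSeries b x.
Proof.
intros Ha Hb. rewrite <- !PSeries_scal, <- PSeries_plus.
- now apply PSeries_ext.
- apply CV_radius_inside, CV_radius_infty_inside, CV_radius_scal_infty, Ha.
- apply CV_radius_inside, CV_radius_infty_inside, CV_radius_scal_infty, Hb.
Qed.

Lemma entire_scal m c : entire c -> entire (CPS_scal m c).
Proof.
intros [H1 H2]. split.
- rewrite <- (CV_radius_Cscal (Re m) (- Im m) _ _ H1 H2).
  apply CV_radius_ext. intros k. unfold CPS_scal. rewrite re_mult. ring.
- rewrite <- (CV_radius_Cscal (Im m) (Re m) _ _ H1 H2).
  apply CV_radius_ext. intros k. unfold CPS_scal. rewrite im_mult. ring.
Qed.

Lemma entire_derive c : entire c -> entire (CPS_derive c).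
Proof.
intros [H1 H2]. split.
- rewrite <- H1, <- (CV_radius_derive (fun k => Re (c k))). apply CV_radius_ext. intros k.
  unfold CPS_derive. rewrite re_scal_l. reflexivity.
- rewrite <- H2, <- (CV_radius_derive (fun k => Im (c k))). apply CV_radius_ext. intros k.
  unfold CPS_derive. rewrite im_scal_l. reflexivity.
Qed.

Lemma entire_incr c : entire c -> entire (CPS_incr c).
Proof.
intros [H1 H2]. split.
- rewrite <- H1, <- (CV_radius_incr_1 (fun k => Re (c k))). apply CV_radius_ext. now intros [|k].
- rewrite <- H2, <- (CV_radius_incr_1 (fun k => Im (c k))). apply CV_radius_ext. now intros [|k].
Qed.

Lemma entire_decr c : entire c -> entire (CPS_decr c).
Proof.
intros [H1 H2]. split.
- now rewrite <- H1, <- (CV_radius_decr_1 (fun k => Re (c k))).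
- now rewrite <- H2, <- (CV_radius_decr_1 (fun k => Im (c k))).
Qed.

Lemma CPSeries_ext c d x : (forall k, c k = d k) -> CPSeries c x = CPSeries d x.
Proof.
intros H. unfold CPSeries. f_equal; apply PSeries_ext; intros k; now rewrite H.
Qed.

Lemma CPSeries_plus c d x :
  entire c -> entire d -> CPSeries (CPS_plus c d) x = (CPSeries c x + CPSeries d x)%C.
Proof.
intros [? ?] [? ?]. apply injective_projections; simpl.
- apply (PSeries_plus (fun k => Re (c k)) (fun k => Re (d k)));
    apply CV_radius_inside, CV_radius_infty_inside; assumption.
- apply (PSeries_plus (fun k => Im (c k)) (fun k => Im (d k)));
    apply CV_radius_inside, CV_radius_infty_inside; assumption.
Qed.

Lemma CPSeries_scal m c x : entire c -> CPSeries (CPS_scal m c) x = (m * CPSeries c x)%C.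
Proof.
intros [H1 H2]. apply injective_projections; simpl.
- change (fst m) with (Re m). change (snd m) with (Im m).
  unfold Rminus. rewrite Ropp_mult_distr_l, <- PSeries_Cscal by assumption.
  apply PSeries_ext. intros k. simpl. unfold Re, Im. ring.
- change (fst m) with (Re m). change (snd m) with (Im m).
  rewrite <- PSeries_Cscal by assumption.
  apply PSeries_ext. intros k. simpl. unfold Re, Im. ring.
Qed.

Lemma CPSeries_incr c x : CPSeries (CPS_incr c) x = (RtoC x * CPSeries c x)%C.
Proof.
apply injective_projections; simpl; rewrite Rmult_0_l.
- rewrite Rminus_0_r, <- PSeries_incr_1. apply PSeries_ext. now intros [|k].
- rewrite Rplus_0_r, <- PSeries_incr_1. apply PSeries_ext. now intros [|k].
Qed.

Lemma CPSeries_decr c x :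
  entire c -> CPSeries c x = (c O + RtoC x * CPSeries (CPS_decr c) x)%C.
Proof.
intros [H1 H2]. apply injective_projections; simpl; rewrite Rmult_0_l.
- rewrite Rminus_0_r.
  now rewrite PSeries_decr_1 by now apply CV_radius_inside, CV_radius_infty_inside.
- rewrite Rplus_0_r.
  now rewrite PSeries_decr_1 by now apply CV_radius_inside, CV_radius_infty_inside.
Qed.

Lemma CPSeries_zero x : CPSeries (fun _ => RtoC 0) x = RtoC 0.
Proof. unfold CPSeries. simpl. now rewrite PSeries_const_0. Qed.

Lemma is_Cderive_CPSeries c x :
  entire c -> is_Cderive (CPSeries c) x (CPSeries (CPS_derive c) x).
Proof.
intros [H1 H2]. apply is_Cderive_pair.
- evar_last.
  + apply is_derive_PSeries, CV_radius_infty_inside, H1.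
  + apply PSeries_ext. intros k. unfold CPS_derive. now rewrite re_scal_l.
- evar_last.
  + apply is_derive_PSeries, CV_radius_infty_inside, H2.
  + apply PSeries_ext. intros k. unfold CPS_derive. now rewrite im_scal_l.
Qed.

(** All Taylor terms are nonnegative, so one of them is at most the partial sum, which is at most
    [exp x]. *)
Lemma pow_div_fact_le_exp (x : R) (n : nat) : 0 <= x -> x ^ n / INR (fact n) <= exp x.
Proof.
intros Hx. eapply Rle_trans; [|apply (exp_ge_taylor x n Hx)].
assert (P : forall k, 0 <= x ^ k / INR (fact k)).
{ intros k. apply Rdiv_le_0_compat; [now apply pow_le | apply INR_fact_lt_0]. }
destruct n as [|n]; [apply Rle_refl|]. rewrite tech5.
generalize (cond_pos_sum (fun k => x ^ k / INR (fact k)) n P). lra.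
Qed.

(** For every [r >= 0] the terms [a n * r^n] are bounded by [K * exp (M * r)], so the radius is at
    least [r]. *)
Lemma CV_radius_exp_bounded (a : nat -> R) (K M : R) :
  0 <= K -> 0 <= M -> (forall k, Rabs (a k) <= K * (M ^ k / INR (fact k))) ->
  CV_radius a = p_infty.
Proof.
intros HK HM H.
assert (L : forall r, 0 <= r -> Rbar_le r (CV_radius a)).
{ intros r Hr. apply (CV_radius_bounded a). exists (K * exp (M * r)). intros n.
  rewrite Rabs_mult, (Rabs_pos_eq (r ^ n)) by now apply pow_le.
  apply Rle_trans with (K * (M ^ n / INR (fact n)) * r ^ n).
  - apply Rmult_le_compat_r; [now apply pow_le | apply H].
  - replace (K * (M ^ n / INR (fact n)) * r ^ n) with (K * ((M * r) ^ n / INR (fact n)))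
      by (rewrite Rpow_mult_distr; field; apply INR_fact_neq_0).
    apply Rmult_le_compat_l; [exact HK|].
    apply pow_div_fact_le_exp. now apply Rmult_le_pos. }
destruct (CV_radius a) as [r | |]; [|reflexivity|].
(* A finite radius [r] would be at least [Rabs r + 1]. *)
- specialize (L (Rabs r + 1)). simpl in L.
  generalize (Rabs_pos r) (Rle_abs r). intros. lra.
- now specialize (L 0 (Rle_refl 0)).
Qed.

Lemma entire_exp_bounded (c : nat -> C) (K M : R) :
  0 <= K -> 0 <= M -> (forall k, Cmod (c k) <= K * (M ^ k / INR (fact k))) -> entire c.
Proof.
intros HK HM H. split; apply (CV_radius_exp_bounded _ K M HK HM); intros k.
- eapply Rle_trans; [|apply H]. eapply Rle_trans; [|apply Rmax_Cmod]. apply Rmax_l.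
- eapply Rle_trans; [|apply H]. eapply Rle_trans; [|apply Rmax_Cmod]. apply Rmax_r.
Qed.

(** * Coefficients of the Bessel functions *)

Definition besselJ1_coef (k : nat) : R := (-1) ^ k / (INR (fact k) * INR (fact (k + 1))).

Definition digamma_sum (k : nat) : R := digamma_S k + digamma_S (k + 1).

(** Coefficients of the series P, and below in [y1_seq] of Q: for [m = s^2 / 4] the factor [m^k] is
    the power [(s / 2)^(2k)]. *)
Definition j1_seq (m : C) (k : nat) : C := (RtoC (besselJ1_coef k) * m ^ k)%C.

Definition y1_seq (m : C) (k : nat) : C :=
  (RtoC (besselJ1_coef k * digamma_sum k) * m ^ k)%C.

Lemma harmonic_S n : harmonic (S n) = harmonic n + / INR (S n).
Proof. unfold harmonic. rewrite sum_n_Sm by lia. reflexivity. Qed.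

Lemma harmonic_bounds n : 0 <= harmonic n <= INR n.
Proof.
induction n as [|n IH].
(* The sum from 1 to 0 is empty, so [harmonic 0] is 0. *)
- unfold harmonic. rewrite sum_n_m_zero by lia. simpl. unfold zero; simpl. lra.
- rewrite harmonic_S.
  assert (P : 1 <= INR (S n)) by (rewrite S_INR; generalize (pos_INR n); lra).
  assert (I : 0 < / INR (S n)) by (apply Rinv_0_lt_compat; lra).
  assert (J : / INR (S n) <= 1) by (rewrite <- Rinv_1; apply Rinv_le_contravar; lra).
  rewrite S_INR in *. lra.
Qed.

Lemma digamma_sum_S k : digamma_sum (S k) = digamma_sum k + / INR (k + 1) + / INR (k + 2).
Proof.
unfold digamma_sum, digamma_S.
replace (S k + 1)%nat with (S (S k)) by lia.
replace (k + 1)%nat with (S k) by lia. replace (k + 2)%nat with (S (S k)) by lia.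
rewrite (harmonic_S (S k)), (harmonic_S k). ring.
Qed.

Lemma besselJ1_coef_S k :
  besselJ1_coef (S k) = - besselJ1_coef k / (INR (k + 1) * INR (k + 2)).
Proof.
unfold besselJ1_coef.
replace (S k + 1)%nat with (S (k + 1)) by lia.
rewrite !fact_simpl, !mult_INR.
replace (S (k + 1)) with (k + 2)%nat by lia. replace (S k) with (k + 1)%nat at 2 by lia.
rewrite <- tech_pow_Rmult. field.
repeat split; try apply INR_fact_neq_0; apply not_0_INR; lia.
Qed.

Lemma besselJ1_coef_abs k :
  Rabs (besselJ1_coef k) = / INR (fact k) * / (INR (k + 1) * INR (fact k)).
Proof.
unfold besselJ1_coef. unfold Rdiv. rewrite Rabs_mult, pow_1_abs, Rmult_1_l, Rabs_inv.
replace (k + 1)%nat with (S k) by lia. rewrite fact_simpl, mult_INR.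
rewrite Rabs_pos_eq, Rinv_mult; [reflexivity|].
repeat apply Rmult_le_pos; try apply pos_INR.
Qed.

(** The factor [k + 1] is absorbed by [(k + 1)!], and one of the two remaining factors [1 / k!] is
    at most 1. Multipliers of linear growth, such as [digamma_sum], therefore keep the series
    entire. *)
Lemma besselJ1_coef_bound k : INR (k + 1) * Rabs (besselJ1_coef k) <= / INR (fact k).
Proof.
rewrite besselJ1_coef_abs.
assert (F := INR_fact_lt_0 k).
assert (P : 0 < INR (k + 1)) by (apply lt_0_INR; lia).
replace (INR (k + 1) * (/ INR (fact k) * / (INR (k + 1) * INR (fact k))))
  with (/ INR (fact k) * / INR (fact k)) by (field; lra).
rewrite <- (Rmult_1_r (/ INR (fact k))) at 3.
apply Rmult_le_compat_l; [apply Rlt_le, Rinv_0_lt_compat, F|].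
rewrite <- Rinv_1. apply Rinv_le_contravar; [lra|].
apply (le_INR 1). apply lt_O_fact.
Qed.

Lemma entire_besselJ1_coef_mul (b : nat -> R) (K : R) (m : C) :
  0 <= K -> (forall k, Rabs (b k) <= K * INR (k + 1)) ->
  entire (fun k => RtoC (besselJ1_coef k * b k) * m ^ k)%C.
Proof.
intros HK Hb. apply (entire_exp_bounded _ K (Cmod m) HK (Cmod_ge_0 m)).
intros k. rewrite Cmod_mult, Cmod_pow, Cmod_R, Rabs_mult.
unfold Rdiv. rewrite (Rmult_comm (Cmod m ^ k)), <- Rmult_assoc.
apply Rmult_le_compat_r; [apply pow_le, Cmod_ge_0|].
apply Rle_trans with (Rabs (besselJ1_coef k) * (K * INR (k + 1))).
- apply Rmult_le_compat_l; [apply Rabs_pos | apply Hb].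
- rewrite (Rmult_comm K), <- Rmult_assoc, Rmult_comm.
  apply Rmult_le_compat_l; [exact HK|].
  rewrite Rmult_comm. apply besselJ1_coef_bound.
Qed.

Lemma entire_j1 m : entire (j1_seq m).
Proof.
assert (H : entire (fun k => RtoC (besselJ1_coef k * 1) * m ^ k)%C).
{ apply (entire_besselJ1_coef_mul (fun _ => 1) 1); [lra|].
  intros k. rewrite Rabs_R1, Rmult_1_l. apply (le_INR 1). lia. }
destruct H as [H1 H2]. split; [rewrite <- H1 | rewrite <- H2]; apply CV_radius_ext;
  intros k; now rewrite Rmult_1_r.
Qed.

Lemma entire_y1 m : entire (y1_seq m).
Proof.
(* The two harmonic numbers add up to at most [2 k + 1], and Euler's constant occurs twice. *)
apply (entire_besselJ1_coef_mul digamma_sum (2 + 2 * Rabs euler_gamma)).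
- generalize (Rabs_pos euler_gamma). lra.
- intros k. unfold digamma_sum, digamma_S.
  generalize (harmonic_bounds k) (harmonic_bounds (k + 1)) (Rabs_pos euler_gamma)
    (Rle_abs euler_gamma) (Rle_abs (- euler_gamma)) (pos_INR k).
  rewrite Rabs_Ropp, plus_INR. simpl (INR 1). intros.
  assert (0 <= Rabs euler_gamma * INR k) by (apply Rmult_le_pos; assumption).
  apply Rabs_le. split; nra.
Qed.

(** * Recurrences and differential equations of the two series *)

Lemma j1_seq_S m k :
  (RtoC (INR (k + 1) * INR (k + 2)) * j1_seq m (S k))%C = (- (m * j1_seq m k))%C.
Proof.
unfold j1_seq. rewrite besselJ1_coef_S, Cpow_S.
assert (N1 : RtoC (INR (k + 1)) <> RtoC 0) by (apply RtoC_neq_0, not_0_INR; lia).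
assert (N2 : RtoC (INR (k + 2)) <> RtoC 0) by (apply RtoC_neq_0, not_0_INR; lia).
assert (N : INR (k + 1) * INR (k + 2) <> 0)
  by (apply Rmult_integral_contrapositive_currified; apply not_0_INR; lia).
rewrite RtoC_div, RtoC_opp, RtoC_mult by exact N. field. now split.
Qed.

(** [y1_seq] is [digamma_sum] times [j1_seq]. The increment [1/(k+1) + 1/(k+2)] of [digamma_sum],
    multiplied by [(k+1)(k+2)], produces the inhomogeneous term. *)
Lemma y1_seq_S m k :
  (RtoC (INR (k + 1) * INR (k + 2)) * y1_seq m (S k))%C
  = (- (m * y1_seq m k) + RtoC (INR (k + 1) + INR (k + 2)) * j1_seq m (S k))%C.
Proof.
assert (N1 : INR (k + 1) <> 0) by (apply not_0_INR; lia).
assert (N2 : INR (k + 2) <> 0) by (apply not_0_INR; lia).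
assert (E : forall n, y1_seq m n = (RtoC (digamma_sum n) * j1_seq m n)%C).
{ intros n. unfold y1_seq, j1_seq. rewrite RtoC_mult. ring. }
rewrite !E, digamma_sum_S.
transitivity (RtoC (digamma_sum k) * (RtoC (INR (k + 1) * INR (k + 2)) * j1_seq m (S k))
  + RtoC ((/ INR (k + 1) + / INR (k + 2)) * (INR (k + 1) * INR (k + 2))) * j1_seq m (S k))%C.
- rewrite !RtoC_mult, !RtoC_plus. ring.
- rewrite j1_seq_S.
  replace ((/ INR (k + 1) + / INR (k + 2)) * (INR (k + 1) * INR (k + 2)))
    with (INR (k + 1) + INR (k + 2)) by (field; split; assumption).
  ring.
Qed.

Ltac prove_entire :=
  repeat match goal with
  | H : entire ?c |- entire ?c => exact H
  | |- entire (CPS_plus _ _) => apply entire_plus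
  | |- entire (CPS_scal _ _) => apply entire_scal
  | |- entire (CPS_incr _) => apply entire_incr
  | |- entire (CPS_decr _) => apply entire_decr
  | |- entire (CPS_derive _) => apply entire_derive
  end.

(** At [x^k] the first two terms contribute [k (k+1)] and [2 (k+1)] times [c (S k)], with sum
    [(k+1)(k+2)]. *)
Lemma CPSeries_ode_operator (c : nat -> C) (m : C) (x : R) : entire c ->
  (RtoC x * CPSeries (CPS_derive (CPS_derive c)) x
   + 2 * CPSeries (CPS_derive c) x + m * CPSeries c x)%C
  = CPSeries (fun k => RtoC (INR (k + 1) * INR (k + 2)) * c (S k) + m * c k)%C x.
Proof.
intros H.
assert (H1 := entire_derive _ H). assert (H2 := entire_derive _ H1).
rewrite <- CPSeries_incr, <- !CPSeries_scal, <- !CPSeries_plus; prove_entire.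
apply CPSeries_ext. intros k. unfold CPS_plus, CPS_scal, CPS_derive.
replace (k + 2)%nat with (S (S k)) by lia. replace (k + 1)%nat with (S k) by lia.
destruct k as [|k]; unfold CPS_incr; rewrite ?S_INR, ?RtoC_mult, ?RtoC_plus; simpl INR; ring.
Qed.

Lemma j1_ode m x :
  (RtoC x * CPSeries (CPS_derive (CPS_derive (j1_seq m))) x
   + 2 * CPSeries (CPS_derive (j1_seq m)) x + m * CPSeries (j1_seq m) x)%C = RtoC 0.
Proof.
rewrite CPSeries_ode_operator by apply entire_j1. rewrite <- (CPSeries_zero x).
apply CPSeries_ext. intros k. rewrite j1_seq_S. ring.
Qed.

(** Splitting [(k+1) + (k+2)] as [2 (k+1) + 1] gives [2 P'] and the shifted series. The latter
    stands for [(P - 1) / x], so that the equation also makes sense at [x = 0]. *)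
Lemma y1_ode m x :
  (RtoC x * CPSeries (CPS_derive (CPS_derive (y1_seq m))) x
   + 2 * CPSeries (CPS_derive (y1_seq m)) x + m * CPSeries (y1_seq m) x)%C
  = (2 * CPSeries (CPS_derive (j1_seq m)) x + CPSeries (CPS_decr (j1_seq m)) x)%C.
Proof.
assert (H := entire_j1 m).
rewrite CPSeries_ode_operator by apply entire_y1.
rewrite <- CPSeries_scal, <- CPSeries_plus; prove_entire.
apply CPSeries_ext. intros k. rewrite y1_seq_S.
unfold CPS_plus, CPS_scal, CPS_derive, CPS_decr.
rewrite !S_INR, !plus_INR. simpl INR. rewrite !RtoC_plus. ring.
Qed.

Lemma j1_decr m x :
  CPSeries (j1_seq m) x = (1 + RtoC x * CPSeries (CPS_decr (j1_seq m)) x)%C.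
Proof.
rewrite CPSeries_decr by apply entire_j1. f_equal.
unfold j1_seq, besselJ1_coef. simpl. rewrite Cmult_1_r. f_equal. field.
Qed.

(* With [x = t^2] and [m = s^2 / 4] this is [pi t^3] times the Wronskian of [J_1(s t) / t] and
   [Y_1(s t) / t]; the logarithm cancels. *)
Lemma j1_y1_wronskian m x :
  let P := CPSeries (j1_seq m) x in
  let P' := CPSeries (CPS_derive (j1_seq m)) x in
  let Q := CPSeries (y1_seq m) x in
  let Q' := CPSeries (CPS_derive (y1_seq m)) x in
  0 <= x ->
  (2 * P + 2 * RtoC x * P' + 2 * m * (RtoC x * P * P - RtoC x * RtoC x * (P * Q' - P' * Q)))%C
  = RtoC 2.
Proof.
intros P P' Q Q' Hx. unfold P, P', Q, Q'; clear P P' Q Q'.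
assert (HJ := entire_j1 m). assert (HY := entire_y1 m).
assert (DP := fun u => is_Cderive_CPSeries _ u HJ).
assert (DP' := fun u => is_Cderive_CPSeries _ u (entire_derive _ HJ)).
assert (DQ := fun u => is_Cderive_CPSeries _ u HY).
assert (DQ' := fun u => is_Cderive_CPSeries _ u (entire_derive _ HY)).
assert (Dx : forall u, is_Cderive RtoC u (RtoC 1)).
{ intros u. apply (is_Cderive_RtoC (fun v => v)). apply (is_derive_id u). }
set (V := fun x => (2 * CPSeries (j1_seq m) x + 2 * RtoC x * CPSeries (CPS_derive (j1_seq m)) x
  + 2 * m * (RtoC x * CPSeries (j1_seq m) x * CPSeries (j1_seq m) x
     - RtoC x * RtoC x * (CPSeries (j1_seq m) x * CPSeries (CPS_derive (y1_seq m)) x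
        - CPSeries (CPS_derive (j1_seq m)) x * CPSeries (y1_seq m) x)))%C).
change (V x = RtoC 2).
transitivity (V 0).
(* At 0 every term with a factor [x] vanishes and [P(0) = 1]. *)
2:{ unfold V. rewrite j1_decr at 1. ring. }
apply (is_Cderive_0_constant V 0); [|exact Hx].
intros u _. unfold V.
eapply is_Cderive_eq.
- repeat match goal with
  | |- is_Cderive (fun _ => Cplus _ _) _ _ => apply is_Cderive_plus
  | |- is_Cderive (fun _ => Cminus _ _) _ _ => apply is_Cderive_minus
  | |- is_Cderive (fun _ => Cmult _ _) _ _ => apply is_Cderive_mult
  | |- is_Cderive (fun _ => RtoC 2) _ _ => apply is_Cderive_const
  | |- is_Cderive (fun _ => m) _ _ => apply is_Cderive_const
  | |- is_Cderive (CPSeries (CPS_derive (j1_seq m))) _ _ => apply DP'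
  | |- is_Cderive (CPSeries (CPS_derive (y1_seq m))) _ _ => apply DQ'
  | |- is_Cderive (CPSeries (j1_seq m)) _ _ => apply DP
  | |- is_Cderive (CPSeries (y1_seq m)) _ _ => apply DQ
  | |- is_Cderive RtoC _ _ => apply Dx
  end.
- cbv beta.
  generalize (j1_ode m u) (y1_ode m u) (j1_decr m u).
  generalize (CPSeries (CPS_derive (CPS_derive (j1_seq m))) u)
   (CPSeries (CPS_derive (CPS_derive (y1_seq m))) u)
   (CPSeries (CPS_derive (j1_seq m)) u) (CPSeries (CPS_derive (y1_seq m)) u)
   (CPSeries (j1_seq m) u) (CPSeries (y1_seq m) u) (CPSeries (CPS_decr (j1_seq m)) u).
  intros P2 Q2 P1 Q1 P Q R E1 E2 E3.
  set (X := RtoC u) in *.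
  assert (F1 : (X * P2 = - (2 * P1 + m * P))%C).
  { transitivity ((X * P2 + 2 * P1 + m * P) - (2 * P1 + m * P))%C; [ring|]. rewrite E1. ring. }
  assert (F2 : (X * Q2 = 2 * P1 + R - (2 * Q1 + m * Q))%C).
  { transitivity ((X * Q2 + 2 * Q1 + m * Q) - (2 * Q1 + m * Q))%C; [ring|]. rewrite E2. ring. }
  assert (F3 : (X * R = P - 1)%C) by (rewrite E3; ring).
  (* The derivative of [V], grouped so that second derivatives occur only in the products [X * P2]
     and [X * Q2]. The equations supply these without dividing by [X], which may be 0. *)
  transitivity (4 * P1 + 2 * (X * P2) + 2 * m * (P * P + 2 * X * P * P1
    - 2 * X * (P * Q1 - P1 * Q) - X * P * (X * Q2) + X * Q * (X * P2)))%C; [ring|].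
  rewrite F1, F2.
  transitivity (2 * m * (P * P - P - P * (X * R)))%C; [ring|].
  rewrite F3. ring.
Qed.

(** * Bessel functions along a ray *)

Lemma CPSeries_CSeries c x : CPSeries c x = CSeries (fun k => c k * RtoC (x ^ k))%C.
Proof.
unfold CPSeries, CSeries, PSeries. f_equal; apply Series_ext; intros k.
- now rewrite re_scal_r.
- now rewrite im_scal_r.
Qed.

Lemma CSeries_ext a b : (forall k, a k = b k) -> CSeries a = CSeries b.
Proof. intros H. unfold CSeries. f_equal; apply Series_ext; intros k; now rewrite H. Qed.

(** Write [z^(2k+1)] as [z (z^2)^k] and split [z^2] into [m], which joins the coefficients, and the
    real variable [x]. Applied with [z = s t / 2], [m = s^2 / 4], [x = t^2]. *)
Lemma CSeries_odd_powers (b : nat -> R) (c : nat -> C) (m z : C) (x : R) :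
  entire c -> (forall k, c k = RtoC (b k) * m ^ k)%C -> (z * z)%C = (m * RtoC x)%C ->
  CSeries (fun k => RtoC (b k) * z ^ (2 * k + 1))%C = (z * CPSeries c x)%C.
Proof.
intros Hc Hb Hz. rewrite <- CPSeries_scal, CPSeries_CSeries by exact Hc.
apply CSeries_ext. intros k. unfold CPS_scal. rewrite Hb, RtoC_pow.
rewrite Cpow_add_r, Cpow_mult_r, Cpow_1_r.
replace (z ^ 2)%C with (m * RtoC x)%C by (rewrite <- Hz; simpl; ring).
rewrite Cpow_mult_l. ring.
Qed.

Lemma half_square (s : C) (t : R) :
  (s * RtoC t / 2 * (s * RtoC t / 2))%C = (s * s / 4 * RtoC (t ^ 2))%C.
Proof. rewrite RtoC_pow. field. Qed.

Lemma BesselJ1_real_scaling (s : C) (t : R) :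
  BesselJ1 (s * RtoC t) = (s * RtoC t / 2 * CPSeries (j1_seq (s * s / 4)) (t ^ 2))%C.
Proof.
apply (CSeries_odd_powers besselJ1_coef _ (s * s / 4)).
- apply entire_j1.
- reflexivity.
- apply half_square.
Qed.

Lemma Carg_real_scaling (z : C) (t : R) : 0 < t -> Carg (z * RtoC t) = Carg z.
Proof.
intros Ht. unfold Carg. rewrite re_scal_r, im_scal_r, Cmod_mult, Cmod_R, Rabs_pos_eq by lra.
assert (E : Re z * t / (Cmod z * t) = Re z / Cmod z).
{ unfold Rdiv. rewrite Rinv_mult.
  replace (Re z * t * (/ Cmod z * / t)) with (Re z * / Cmod z * (t * / t)) by ring.
  rewrite Rinv_r by lra. ring. }
rewrite E.
destruct (Rle_dec 0 (Im z)) as [H|H], (Rle_dec 0 (Im z * t)) as [H'|H']; try reflexivity.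
- elim H'. apply Rmult_le_pos; lra.
- elim H. apply Rmult_le_reg_r with t; lra.
Qed.

(** A positive factor leaves the principal argument unchanged, so no multiple of [2 pi i] appears,
    even on the cut. *)
Lemma Clog_real_scaling (z : C) (t : R) :
  z <> RtoC 0 -> 0 < t -> Clog (z * RtoC t) = (RtoC (ln t) + Clog z)%C.
Proof.
intros Hz Ht. unfold Clog. rewrite Carg_real_scaling by exact Ht.
rewrite Cmod_mult, Cmod_R, Rabs_pos_eq, ln_mult by (try apply Cmod_gt_0; trivial; lra).
apply injective_projections; simpl; ring.
Qed.

Lemma RtoC_PI_neq_0 : RtoC PI <> RtoC 0.
Proof. apply RtoC_neq_0, PI_neq0. Qed.

Lemma BesselY1_real_scaling (s : C) (t : R) : s <> RtoC 0 -> 0 < t ->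
  BesselY1 (s * RtoC t) =
  (- (2 / (RtoC PI * (s * RtoC t)))
   + 2 / RtoC PI * (RtoC (ln t) + Clog (s / 2))
     * (s * RtoC t / 2 * CPSeries (j1_seq (s * s / 4)) (t ^ 2))
   - / RtoC PI * (s * RtoC t / 2 * CPSeries (y1_seq (s * s / 4)) (t ^ 2)))%C.
Proof.
intros Hs Ht. unfold BesselY1. rewrite BesselJ1_real_scaling.
assert (H2 : RtoC 2 <> RtoC 0) by (apply RtoC_neq_0; lra).
replace (Clog (s * RtoC t / 2)) with (RtoC (ln t) + Clog (s / 2))%C.
2:{ rewrite <- Clog_real_scaling; [f_equal; field; exact H2 | | exact Ht].
    intros E. apply Hs. replace s with (s / 2 * 2)%C by (field; exact H2). rewrite E. ring. }
f_equal. f_equal. f_equal.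
apply (CSeries_odd_powers _ _ (s * s / 4)).
- apply entire_y1.
- intros k. unfold y1_seq, besselJ1_coef, digamma_sum. f_equal. f_equal. unfold Rdiv. ring.
- apply half_square.
Qed.

Lemma is_Cderive_CPSeries_square c t : entire c ->
  is_Cderive (fun u => CPSeries c (u ^ 2)) t
    (2 * RtoC t * CPSeries (CPS_derive c) (t ^ 2))%C.
Proof.
intros Hc. refine (is_Cderive_eq _ _ _ _
  (is_Cderive_comp (CPSeries c) (fun u => u ^ 2) t _ (2 * t) (is_Cderive_CPSeries c _ Hc) _) _).
- auto_derive; [easy | ring].
- now rewrite RtoC_mult.
Qed.

Lemma is_Cderive_CPSeries_square_2 c t : entire c ->
  is_Cderive (fun u => 2 * RtoC u * CPSeries (CPS_derive c) (u ^ 2))%C t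
    (2 * CPSeries (CPS_derive c) (t ^ 2)
     + 4 * RtoC (t ^ 2) * CPSeries (CPS_derive (CPS_derive c)) (t ^ 2))%C.
Proof.
intros Hc. eapply is_Cderive_eq.
- apply is_Cderive_mult; [|apply is_Cderive_CPSeries_square, entire_derive, Hc].
  apply (is_Cderive_mult (fun _ => RtoC 2) RtoC); [apply is_Cderive_const|].
  apply (is_Cderive_RtoC (fun v => v) t 1), (is_derive_id t).
- cbv beta. rewrite RtoC_pow. ring.
Qed.

(** * The two Bessel solutions and their Wronskian *)

Section BesselSolutions.

Variables (s : C) (t0 : R).
Hypotheses (s_neq_0 : s <> RtoC 0) (t0_pos : 0 < t0).

Let m : C := (s * s / 4)%C.
Let P (t : R) : C := CPSeries (j1_seq m) (t ^ 2).
Let P1 (t : R) : C := CPSeries (CPS_derive (j1_seq m)) (t ^ 2).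
Let P2 (t : R) : C := CPSeries (CPS_derive (CPS_derive (j1_seq m))) (t ^ 2).
Let Q (t : R) : C := CPSeries (y1_seq m) (t ^ 2).
Let Q1 (t : R) : C := CPSeries (CPS_derive (y1_seq m)) (t ^ 2).
Let Q2 (t : R) : C := CPSeries (CPS_derive (CPS_derive (y1_seq m))) (t ^ 2).
Let L (t : R) : C := (RtoC (ln t) + Clog (s / 2))%C.

(** [j1_sol] and [y1_sol] are [J_1(s t) / t] and [Y_1(s t) / t] with the division by [t] carried
    out; primes mark derivatives in [t]. *)
Definition j1_sol (t : R) : C := (s / 2 * P t)%C.
Definition j1_sol' (t : R) : C := (s / 2 * (2 * RtoC t * P1 t))%C.
Definition j1_sol'' (t : R) : C := (s / 2 * (2 * P1 t + 4 * RtoC (t ^ 2) * P2 t))%C.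

Definition y1_sol (t : R) : C :=
  (- (2 / (RtoC PI * s)) * RtoC (/ t ^ 2) + s / RtoC PI * (L t * P t - / 2 * Q t))%C.
Definition y1_sol' (t : R) : C :=
  (- (2 / (RtoC PI * s)) * RtoC (-2 / t ^ 3)
   + s / RtoC PI * (RtoC (/ t) * P t + L t * (2 * RtoC t * P1 t)
                    - / 2 * (2 * RtoC t * Q1 t)))%C.
Definition y1_sol'' (t : R) : C :=
  (- (2 / (RtoC PI * s)) * RtoC (6 / t ^ 4)
   + s / RtoC PI * (RtoC (- / t ^ 2) * P t + 2 * (RtoC (/ t) * (2 * RtoC t * P1 t))
                    + L t * (2 * P1 t + 4 * RtoC (t ^ 2) * P2 t)
                    - / 2 * (2 * Q1 t + 4 * RtoC (t ^ 2) * Q2 t)))%C.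

Lemma j1_sol_solves : solves (s * s) t0 j1_sol j1_sol' j1_sol''.
Proof.
intros t Ht. split; [|split].
- apply is_Cderive_cmul, is_Cderive_CPSeries_square, entire_j1.
- apply is_Cderive_cmul, is_Cderive_CPSeries_square_2, entire_j1.
- assert (N : RtoC t <> RtoC 0) by (apply RtoC_neq_0; lra).
  generalize (j1_ode m (t ^ 2)). fold (P t) (P1 t) (P2 t). intros E.
  unfold j1_sol, j1_sol', j1_sol''.
  (* With [x = t^2] and [s^2 = 4 m], the operator in [t] is four times [x D^2 + 2 D + m] in [x]; the
     prefactor [s / 2] makes this [2 s]. *)
  transitivity (2 * s * (RtoC (t ^ 2) * P2 t + 2 * P1 t + m * P t))%C.
  + unfold m. rewrite RtoC_div by lra. field. repeat split; assumption.
  + rewrite E. ring.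
Qed.

Lemma y1_sol_solves : solves (s * s) t0 y1_sol y1_sol' y1_sol''.
Proof.
intros t Ht.
assert (N : RtoC t <> RtoC 0) by (apply RtoC_neq_0; lra).
assert (Hpow : forall n, t ^ n <> 0) by (intros n; apply pow_nonzero; lra).
assert (DP := is_Cderive_CPSeries_square _ t (entire_j1 m)).
assert (DP1 := is_Cderive_CPSeries_square_2 _ t (entire_j1 m)).
assert (DQ := is_Cderive_CPSeries_square _ t (entire_y1 m)).
assert (DQ1 := is_Cderive_CPSeries_square_2 _ t (entire_y1 m)).
assert (DL : is_Cderive L t (RtoC (/ t))).
{ refine (is_Cderive_eq _ _ _ _ (is_Cderive_plus _ _ _ _ _
    (is_Cderive_RtoC ln t (/ t) _) (is_Cderive_const _ t)) _); [|ring].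
  apply is_derive_Reals, derivable_pt_lim_ln. lra. }
assert (DI : is_Cderive (fun u => RtoC (/ u)) t (RtoC (- / t ^ 2))).
{ apply is_Cderive_RtoC. auto_derive; [lra | field; lra]. }
split; [|split].
- eapply is_Cderive_eq.
  + apply is_Cderive_plus; apply is_Cderive_cmul.
    * apply is_Cderive_RtoC. auto_derive; [apply (Hpow 2%nat) | reflexivity].
    * apply is_Cderive_minus; [apply is_Cderive_mult; [exact DL | exact DP]|].
      apply is_Cderive_cmul. exact DQ.
  + unfold y1_sol'. f_equal. f_equal. f_equal. field. lra.
- eapply is_Cderive_eq.
  + apply is_Cderive_plus; apply is_Cderive_cmul.
    * apply is_Cderive_RtoC. auto_derive; [apply (Hpow 3%nat) | reflexivity].
    * apply is_Cderive_minus;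
        [apply is_Cderive_plus; apply is_Cderive_mult; [exact DI | exact DP | exact DL | exact DP1]|].
      apply is_Cderive_cmul. exact DQ1.
  + unfold y1_sol''. f_equal.
    * f_equal. f_equal. field. lra.
    * fold (P t) (P1 t) (P2 t) (Q1 t) (Q2 t). ring.
- assert (NP := RtoC_PI_neq_0).
  generalize (j1_ode m (t ^ 2)) (y1_ode m (t ^ 2)) (j1_decr m (t ^ 2)).
  fold (P t) (P1 t) (P2 t) (Q t) (Q1 t) (Q2 t).
  generalize (CPSeries (CPS_decr (j1_seq m)) (t ^ 2)). intros r E1 E2 E3.
  unfold y1_sol, y1_sol', y1_sol''.
  (* The first two groups come from [L P] and [Q]. In the third, differentiating [L] gives
     [4 P' + 2 P / t^2]; the [-2 / t^2] is [s^2] times the polar term, whose derivative terms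
     cancel. The equation for Q makes the last two groups cancel. *)
  transitivity (4 * s / RtoC PI * L t * (RtoC (t ^ 2) * P2 t + 2 * P1 t + m * P t)
    - 2 * s / RtoC PI * (RtoC (t ^ 2) * Q2 t + 2 * Q1 t + m * Q t)
    + s / RtoC PI * (4 * P1 t + 2 * (P t - 1) / RtoC (t ^ 2)))%C.
  + unfold m. rewrite ?RtoC_div, ?RtoC_inv, ?RtoC_opp, ?RtoC_inv, ?RtoC_pow by (try lra; apply Hpow).
    field. repeat split; assumption.
  + rewrite E1, E2, E3, RtoC_pow. field. split; assumption.
Qed.

(** The value is [2 / (pi t0^3)], read off from [j1_y1_wronskian] at [x = t0^2]. *)
Lemma j1_y1_sol_wronskian : wronskian j1_sol j1_sol' y1_sol y1_sol' t0 <> RtoC 0.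
Proof.
assert (N : RtoC t0 <> RtoC 0) by (apply RtoC_neq_0; lra).
assert (N2 : RtoC 2 <> RtoC 0) by (apply RtoC_neq_0; lra).
assert (NP := RtoC_PI_neq_0).
assert (Hpow : forall n, t0 ^ n <> 0) by (intros n; apply pow_nonzero; lra).
assert (E : (RtoC PI * RtoC (t0 ^ 3) * wronskian j1_sol j1_sol' y1_sol y1_sol' t0)%C = RtoC 2).
{ rewrite <- (j1_y1_wronskian m (t0 ^ 2)) by (apply pow2_ge_0).
  fold (P t0) (P1 t0) (Q t0) (Q1 t0).
  unfold wronskian, j1_sol, j1_sol', y1_sol, y1_sol', m.
  rewrite ?RtoC_div, ?RtoC_inv, ?RtoC_opp, ?RtoC_inv, ?RtoC_pow by (try lra; apply Hpow).
  field. repeat split; assumption. }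
intros W. rewrite W, Cmult_0_r in E. now apply N2.
Qed.

End BesselSolutions.

Theorem lemma2 : forall (lam : C) (t0 : R), 0 < t0 ->
  (lam <> RtoC 0 -> forall s : C, is_Csqrt lam s ->
     is_general_solution lam t0 (fun (c1 c2 : C) (t : R) =>
       (/ RtoC t * (c1 * BesselJ1 (s * RtoC t) + c2 * BesselY1 (s * RtoC t)))%C)) /\
  (lam = RtoC 0 ->
     is_general_solution lam t0 (fun (c1 c2 : C) (t : R) =>
       (c1 + c2 * RtoC (/ t ^ 2))%C)).
Proof.
intros lam t0 Ht0. split.
- intros Hlam s [<- _].
  assert (Hs : s <> RtoC 0) by (intros ->; apply Hlam; ring).
  apply (general_solution_of_wronskian _ _ _ _ _ _ _ _ _ Ht0
    (j1_sol_solves s t0 Ht0) (y1_sol_solves s t0 Hs Ht0) (j1_y1_sol_wronskian s t0 Hs Ht0)).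
  intros c1 c2 t Ht.
  (* Since [t > 0], the argument [s t] runs along the ray through [s], where both Bessel functions
     are given by the series in [t^2]. *)
  rewrite BesselJ1_real_scaling, BesselY1_real_scaling by (trivial; lra).
  unfold j1_sol, y1_sol. rewrite RtoC_inv, RtoC_pow by (apply pow_nonzero; lra).
  field. repeat split; trivial; try apply RtoC_PI_neq_0; apply RtoC_neq_0; lra.
- intros ->. now apply zero_frequency_general_solution.
Qed.
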